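(* The system $\mathsf P+\mathsf{QF\text{-}AC}^{1,0}$ proves $\mathsf{GH}^{\mathbb a}_{\mathsf{ns}}\to\Pi^0_1\text{-}\mathsf{TRANS}$.
   Context: Framework. $\mathsf{E\text{-}PA}^{\omega*}$ is Peano arithmetic in all finite types with the axiom of extensionality, with additional types $\rho^*$ of finite sequences; type $0$ = naturals, $1=0\to0$, $2=1\to0$. The language of $\mathsf P$ adds a predicate $\mathrm{st}$ (''standard'') for every type; $(\forall^{\mathrm{st}}x)\varphi\equiv(\forall x)(\mathrm{st}(x)\to\varphi)$, $(\exists^{\mathrm{st}}x)\varphi\equiv(\exists x)(\mathrm{st}(x)\wedge\varphi)$; internal = not containing $\mathrm{st}$. $\mathsf P$ is $\mathsf{E\text{-}PA}^{\omega*}$ plus: (i) $\mathrm{st}(x)\wedge x=y\to\mathrm{st}(y)$; (ii) $\mathrm{st}(t)$ for each closed term $t$; (iii) $\mathrm{st}(f)\wedge\mathrm{st}(x)\to\mathrm{st}(f(x))$; (iv) external induction for every formula; (v) $\mathsf{HAC}_{\mathrm{int}}$: for internal $\varphi$, $(\forall^{\mathrm{st}}x^\rho)(\exists^{\mathrm{st}}y^\tau)\varphi(x,y)\to(\exists^{\mathrm{st}}F^{\rho\to\tau^*})(\forall^{\mathrm{st}}x^\rho)(\exists y\in F(x))\varphi(x,y)$; (vi) idealisation: for internal $\varphi$ with arbitrary parameters, $(\forall^{\mathrm{st}}x^{\sigma^*})(\exists y^\tau)(\forall z^\sigma\in x)\varphi(z,y)\to(\exists y^\tau)(\forall^{\mathrm{st}}x^\sigma)\varphi(x,y)$.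 $\mathsf{QF\text{-}AC}^{1,0}$: for internal quantifier-free $\varphi_0$, $(\forall x^1)(\exists y^0)\varphi_0(x,y)\to(\exists F^2)(\forall x^1)\varphi_0(x,F(x))$. $N\in\Omega$ means $\neg\mathrm{st}(N^0)$. Finite sequences of numbers coded by numbers; $|s|$, $*$, $\overline sM,\overline\alpha k$ (initial segments of length $M$, $k$), $s*00\dots$, $s*11\dots$ ($s$ followed by zeros, resp. ones); $\sigma\preceq\tau$: initial segment. Associates: $\gamma^1\in C$ means $(\forall\beta^1)(\exists k)\gamma(\overline\beta k)>0$ and $(\forall\sigma,\tau,n)((\sigma\preceq\tau\wedge\gamma(\overline\sigma n)>0)\to\gamma(\sigma)=\gamma(\tau))$. The value $\gamma(\alpha)$ is $\gamma(\overline\alpha N)-1$ for $N$ with $\gamma(\overline\alpha N)>0$ (using $\mathsf{QF\text{-}AC}^{1,0}$, $\gamma(\alpha):=\gamma(\overline\alpha F(\alpha))-1$ for a choice function $F$). $\mathsf{GH}(\Gamma,\gamma,s)$: $\Gamma(\gamma,s)=\gamma(s*0*(\lambda n^0)\Gamma(\gamma,s*(n+1)))$. $\hat H(\gamma,s,M)=\gamma(\overline sM*11\dots)$ if $|s|\ge M$, and $\hat H(\gamma,s,M)=\gamma(s*0*\hat H(\gamma,s*1,M)*\dots*\hat H(\gamma,s*M,M)*00\dots)$ otherwise. $\mathsf{GH}^{\mathbb a}_{\mathsf{ns}}$: $(\exists^{\mathrm{st}}\Gamma)\big[(\forall^{\mathrm{st}}\gamma^1\in C)(\forall s^0)\mathsf{GH}(\Gamma,\gamma,s)\wedge(\forall^{\mathrm{st}}\gamma^1\in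 C,s^0)(\forall N\in\Omega)(\hat H(\gamma,s,N)=\Gamma(\gamma,s))\big]$. $\Pi^0_1\text{-}\mathsf{TRANS}$: $(\forall^{\mathrm{st}}f^1)[(\forall^{\mathrm{st}}n)f(n)=0\to(\forall m)f(m)=0]$. *)

(* Defs.v *)
From Stdlib Require Import List.
Import ListNotations.

Set Implicit Arguments.
Unset Strict Implicit.

Inductive ty : Set :=
| tN : ty
| tArr : ty -> ty -> ty
| tSeq : ty -> ty.

Notation "s ~> t" := (tArr s t) (at level 55, right associativity).
Notation T1 := (tN ~> tN).
Notation T2 := (T1 ~> tN).

(* A scope [V] gives, for each type, the set of variables of that type that
   may occur free.  [ext V s] adds one fresh variable [E0] of type [s]; binders
   are therefore typed de Bruijn binders, and syntax over [no_var] is closed.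
   Typed lambda abstraction takes the place of the combinators. *)

Definition scope := ty -> Set.

Inductive no_var : scope := .

Inductive ext (V : scope) (s : ty) : scope :=
| E0 : ext V s s
| ES : forall t, V t -> ext V s t.
Arguments E0 {V s}.
Arguments ES {V s t} _.

Inductive tm (V : scope) : ty -> Set :=
| Var : forall t, V t -> tm V t
| App : forall s t, tm V (s ~> t) -> tm V s -> tm V t
| Lam : forall s t, tm (ext V s) t -> tm V (s ~> t)
| Zero : tm V tN
| Succ : tm V T1
| Rec : forall t, tm V (tN ~> t ~> (t ~> tN ~> t) ~> t)
| Nil : forall s, tm V (tSeq s)
| Cons : forall s, tm V (s ~> tSeq s ~> tSeq s)
| LRec : forall s t, tm V (tSeq s ~> t ~> (t ~> s ~> t) ~> t).
Arguments Var {V t} _.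
Arguments App {V s t} _ _.
Arguments Lam {V} s {t} _.
Arguments Zero {V}.
Arguments Succ {V}.
Arguments Rec {V t}.
Arguments Nil {V s}.
Arguments Cons {V s}.
Arguments LRec {V s t}.

Notation "u · v" := (App u v) (at level 39, left associativity).
Notation v0 := (Var E0).
Notation v1 := (Var (ES E0)).
Notation v2 := (Var (ES (ES E0))).
Notation v3 := (Var (ES (ES (ES E0)))).
Notation v4 := (Var (ES (ES (ES (ES E0))))).

Definition renaming (V W : scope) := forall t, V t -> W t.
Definition substitution (V W : scope) := forall t, V t -> tm W t.

Definition up_ren {V W} s (f : renaming V W) : renaming (ext V s) (ext W s) :=
  fun t x => match x in ext _ _ t return ext W s t with
             | E0 => E0
             | ES y => ES (f _ y)
             end.
Arguments up_ren {V W} s f t x.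

Fixpoint ren V W (f : renaming V W) t (u : tm V t) : tm W t :=
  match u with
  | Var x => Var (f _ x)
  | App a b => App (ren f a) (ren f b)
  | @Lam _ s _ b => Lam s (ren (up_ren s f) b)
  | Zero => Zero
  | Succ => Succ
  | Rec => Rec
  | Nil => Nil
  | Cons => Cons
  | LRec => LRec
  end.

Definition shift {V} s : renaming V (ext V s) := fun t x => ES x.
Arguments shift {V} s t x.
Definition lift V s t (u : tm V t) : tm (ext V s) t := ren (shift s) u.
Arguments lift {V s t} u.

Definition up_sub {V W} s (f : substitution V W) : substitution (ext V s) (ext W s) :=
  fun t x => match x in ext _ _ t return tm (ext W s) t with
             | E0 => v0
             | ES y => lift (f _ y)
             end.
Arguments up_sub {V W} s f t x.

Fixpoint sub V W (f : substitution V W) t (u : tm V t) : tm W t :=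
  match u with
  | Var x => f _ x
  | App a b => App (sub f a) (sub f b)
  | @Lam _ s _ b => Lam s (sub (up_sub s f) b)
  | Zero => Zero
  | Succ => Succ
  | Rec => Rec
  | Nil => Nil
  | Cons => Cons
  | LRec => LRec
  end.

Definition scons V W s (u : tm W s) (f : substitution V W) : substitution (ext V s) W :=
  fun t x => match x in ext _ _ t return tm W s -> tm W t with
             | E0 => fun u => u
             | ES y => fun _ => f _ y
             end u.

Definition ids V : substitution V V := fun t x => Var x.

Inductive fm (V : scope) : Set :=
| Eq : forall t, tm V t -> tm V t -> fm V
| St : forall t, tm V t -> fm V
| Bot : fm V
| Imp : fm V -> fm V -> fm V
| And : fm V -> fm V -> fm V
| Or : fm V -> fm V -> fm V
| All : forall t, fm (ext V t) -> fm V
| Ex : forall t, fm (ext V t) -> fm V.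
Arguments Eq {V t} _ _.
Arguments St {V t} _.
Arguments Bot {V}.
Arguments All {V} t _.
Arguments Ex {V} t _.

Definition Neg V (p : fm V) : fm V := Imp p Bot.
Definition AllSt V t (p : fm (ext V t)) : fm V := All t (Imp (St v0) p).
Definition ExSt V t (p : fm (ext V t)) : fm V := Ex t (And (St v0) p).
Arguments AllSt {V} t _.
Arguments ExSt {V} t _.

Fixpoint fren V W (f : renaming V W) (p : fm V) : fm W :=
  match p with
  | Eq u v => Eq (ren f u) (ren f v)
  | St u => St (ren f u)
  | Bot => Bot
  | Imp p q => Imp (fren f p) (fren f q)
  | And p q => And (fren f p) (fren f q)
  | Or p q => Or (fren f p) (fren f q)
  | @All _ t p => All t (fren (up_ren t f) p)
  | @Ex _ t p => Ex t (fren (up_ren t f) p)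
  end.

Definition flift V s (p : fm V) : fm (ext V s) := fren (shift s) p.
Arguments flift {V s} p.

Fixpoint fsub V W (f : substitution V W) (p : fm V) : fm W :=
  match p with
  | Eq u v => Eq (sub f u) (sub f v)
  | St u => St (sub f u)
  | Bot => Bot
  | Imp p q => Imp (fsub f p) (fsub f q)
  | And p q => And (fsub f p) (fsub f q)
  | Or p q => Or (fsub f p) (fsub f q)
  | @All _ t p => All t (fsub (up_sub t f) p)
  | @Ex _ t p => Ex t (fsub (up_sub t f) p)
  end.

Definition inst V s (u : tm V s) (p : fm (ext V s)) : fm V := fsub (scons u (@ids V)) p.

Fixpoint internal V (p : fm V) : Prop :=
  match p with
  | Eq _ _ => True
  | St _ => False
  | Bot => True
  | Imp p q | And p q | Or p q => internal p /\ internal q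
  | All _ p | Ex _ p => internal p
  end.

(* Equality is primitive at every type, but only numerical equalities count as
   quantifier-free: an equality of functionals is extensionally a universal
   statement. *)
Fixpoint quantifier_free V (p : fm V) : Prop :=
  match p with
  | @Eq _ t _ _ => t = tN
  | Bot => True
  | Imp p q | And p q | Or p q => quantifier_free p /\ quantifier_free q
  | St _ | All _ _ | Ex _ _ => False
  end.

Definition theory := forall V, fm V -> Prop.

Inductive derives (T : theory) : forall V, list (fm V) -> fm V -> Prop :=
| d_ax V (G : list (fm V)) p : T V p -> derives T G p
| d_hyp V (G : list (fm V)) p : In p G -> derives T G p
| d_impI V (G : list (fm V)) p q : derives T (p :: G) q -> derives T G (Imp p q)
| d_impE V (G : list (fm V)) p q :
    derives T G (Imp p q) -> derives T G p -> derives T G q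
| d_dne V (G : list (fm V)) p : derives T G (Neg (Neg p)) -> derives T G p
| d_andI V (G : list (fm V)) p q :
    derives T G p -> derives T G q -> derives T G (And p q)
| d_andE1 V (G : list (fm V)) p q : derives T G (And p q) -> derives T G p
| d_andE2 V (G : list (fm V)) p q : derives T G (And p q) -> derives T G q
| d_orI1 V (G : list (fm V)) p q : derives T G p -> derives T G (Or p q)
| d_orI2 V (G : list (fm V)) p q : derives T G q -> derives T G (Or p q)
| d_orE V (G : list (fm V)) p q r :
    derives T G (Or p q) -> derives T (p :: G) r -> derives T (q :: G) r ->
    derives T G r
| d_allI V (G : list (fm V)) t (p : fm (ext V t)) :
    derives T (map (flift (s := t)) G) p -> derives T G (All t p)
| d_allE V (G : list (fm V)) t (p : fm (ext V t)) u :
    derives T G (All t p) -> derives T G (inst u p)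
| d_exI V (G : list (fm V)) t (p : fm (ext V t)) u :
    derives T G (inst u p) -> derives T G (Ex t p)
| d_exE V (G : list (fm V)) t (p : fm (ext V t)) q :
    derives T G (Ex t p) ->
    derives T (p :: map (flift (s := t)) G) (flift q) ->
    derives T G q.

Definition proves (T : theory) (p : fm no_var) : Prop := derives T [] p.

Definition pred_ {V} : tm V T1 :=
  Lam tN (Rec · v0 · Zero · Lam tN (Lam tN v0)).

Definition plus_ {V} : tm V (tN ~> tN ~> tN) :=
  Lam tN (Lam tN (Rec · v0 · v1 · Lam tN (Lam tN (Succ · v1)))).

Definition monus_ {V} : tm V (tN ~> tN ~> tN) :=
  Lam tN (Lam tN (Rec · v0 · v1 · Lam tN (Lam tN (pred_ · v1)))).

(* [cond_ · c · a · b] is [a] if [c = 0] and [b] otherwise. *)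
Definition cond_ {V t} : tm V (tN ~> t ~> t ~> t) :=
  Lam tN (Lam t (Lam t (Rec · v2 · v1 · Lam t (Lam tN v2)))).

Definition Le V (u v : tm V tN) : fm V := Eq (monus_ · u · v) Zero.
Definition Lt V (u v : tm V tN) : fm V := Le (Succ · u) v.

Fixpoint default V (t : ty) : tm V t :=
  match t with
  | tN => Zero
  | tArr s t => Lam s (default (ext V s) t)
  | tSeq _ => Nil
  end.

Definition len_ {V s} : tm V (tSeq s ~> tN) :=
  Lam (tSeq s) (LRec · v0 · Zero · Lam tN (Lam s (Succ · v1))).

(* [nth_ · x · i] is the [i]-th entry of [x], counted from 0, and a default
   value when [i] is at least the length of [x]. *)
Definition nth_ {V s} : tm V (tSeq s ~> tN ~> s) :=
  Lam (tSeq s)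
    (LRec · v0 · Lam tN (default _ s)
      · Lam (tN ~> s) (Lam s (Lam tN
          (Rec · v0 · v1 · Lam s (Lam tN (v4 · v0)))))).

Definition append_ {V s} : tm V (tSeq s ~> tSeq s ~> tSeq s) :=
  Lam (tSeq s) (Lam (tSeq s)
    (LRec · v1 · v0 · Lam (tSeq s) (Lam s (Cons · v0 · v1)))).

(* [tab_ · f · k] is the sequence [f 0, ..., f (k - 1)]. *)
Definition tab_ {V s} : tm V ((tN ~> s) ~> tN ~> tSeq s) :=
  Lam (tN ~> s) (Lam tN
    (Rec · v0 · Nil
      · Lam (tSeq s) (Lam tN (append_ · v1 · (Cons · (v3 · v0) · Nil))))).

(* [take_ · x · m] is the initial segment of [x] of length [m], or [x] itself
   when [x] is shorter; [m - (m - |x|)] is the minimum of [m] and [|x|]. *)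
Definition take_ {V s} : tm V (tSeq s ~> tN ~> tSeq s) :=
  Lam (tSeq s) (Lam tN
    (tab_ · (nth_ · v1) · (monus_ · v0 · (monus_ · v0 · (len_ · v1))))).

Definition Mem V s (u : tm V s) (x : tm V (tSeq s)) : fm V :=
  Ex tN (And (Lt v0 (len_ · lift x)) (Eq (lift u) (nth_ · lift x · v0))).

Definition succ_var V : substitution (ext V tN) (ext V tN) :=
  scons (Succ · v0) (fun t x => Var (ES x)).

(* Moves a formula in the scope of two binders under one more outer binder. *)
Definition under2 V r s t (p : fm (ext (ext V s) t)) : fm (ext (ext (ext V r) s) t) :=
  fren (up_ren t (up_ren s (shift r))) p.
Arguments under2 {V r s t} p.

Inductive EPA_axiom (V : scope) : fm V -> Prop :=
| ax_refl t (u : tm V t) : EPA_axiom (Eq u u)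
| ax_leibniz t (u v : tm V t) (p : fm (ext V t)) :
    internal p -> EPA_axiom (Imp (Eq u v) (Imp (inst u p) (inst v p)))
| ax_extensionality s t (f g : tm V (s ~> t)) :
    EPA_axiom (Imp (All s (Eq (lift f · v0) (lift g · v0))) (Eq f g))
| ax_beta s t (b : tm (ext V s) t) (u : tm V s) :
    EPA_axiom (Eq (Lam s b · u) (sub (scons u (@ids V)) b))
| ax_succ_neq0 (u : tm V tN) : EPA_axiom (Neg (Eq (Succ · u) Zero))
| ax_succ_inj (u v : tm V tN) :
    EPA_axiom (Imp (Eq (Succ · u) (Succ · v)) (Eq u v))
| ax_rec0 t (a : tm V t) b : EPA_axiom (Eq (Rec · Zero · a · b) a)
| ax_recS t (n : tm V tN) (a : tm V t) b :
    EPA_axiom (Eq (Rec · (Succ · n) · a · b) (b · (Rec · n · a · b) · n))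
| ax_induction (p : fm (ext V tN)) :
    internal p ->
    EPA_axiom (Imp (inst Zero p)
                (Imp (All tN (Imp p (fsub (@succ_var V) p))) (All tN p)))
| ax_seq_cases s (x : tm V (tSeq s)) :
    EPA_axiom (Or (Eq x Nil)
                (Ex s (Ex (tSeq s) (Eq (lift (lift x)) (Cons · v1 · v0)))))
| ax_lrec_nil s t (a : tm V t) (b : tm V (t ~> s ~> t)) :
    EPA_axiom (Eq (LRec · Nil · a · b) a)
| ax_lrec_cons s t (h : tm V s) (x : tm V (tSeq s)) (a : tm V t) b :
    EPA_axiom (Eq (LRec · (Cons · h · x) · a · b) (b · (LRec · x · a · b) · h)).

Inductive P_axiom (V : scope) : fm V -> Prop :=
| P_EPA (p : fm V) : EPA_axiom p -> P_axiom p
| P_st_eq t (u v : tm V t) : P_axiom (Imp (And (St u) (Eq u v)) (St v))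
| P_st_closed t (u : tm no_var t) :
    P_axiom (St (ren (fun s (x : no_var s) => match x with end) u))
| P_st_app s t (f : tm V (s ~> t)) (u : tm V s) :
    P_axiom (Imp (And (St f) (St u)) (St (f · u)))
| P_external_induction (p : fm (ext V tN)) :
    P_axiom (Imp (And (inst Zero p) (AllSt tN (Imp p (fsub (@succ_var V) p))))
              (AllSt tN p))
| P_HAC_int r t (p : fm (ext (ext V r) t)) :
    internal p ->
    P_axiom (Imp (AllSt r (ExSt t p))
              (ExSt (r ~> tSeq t) (AllSt r (Ex t
                (And (Mem v0 (v2 · v1)) (under2 p))))))
| P_idealisation s t (p : fm (ext (ext V t) s)) :
    internal p ->
    P_axiom (Imp (AllSt (tSeq s) (Ex t (All s (Imp (Mem v0 v2) (under2 p)))))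
              (Ex t (AllSt s p))).

Inductive P_QFAC10 (V : scope) : fm V -> Prop :=
| PQ_P (p : fm V) : P_axiom p -> P_QFAC10 p
| PQ_QFAC10 (p : fm (ext (ext V T1) tN)) :
    quantifier_free p ->
    P_QFAC10 (Imp (All T1 (Ex tN p))
               (Ex T2 (All T1
                 (fsub (scons (v1 · v0) (scons v0 (fun t x => Var (ES (ES x))))) p)))).

(* Number sequences are coded by numbers: the code of the empty sequence is 0, and
   the code of [a] followed by [x] is [2 ^ a * (2 * code x + 1)].  This is a
   bijection, with inverse [decode_]. *)

Definition double_ {V} : tm V T1 := Lam tN (plus_ · v0 · v0).

Definition code_ {V} : tm V (tSeq tN ~> tN) :=
  Lam (tSeq tN)
    (LRec · v0 · Zero
      · Lam tN (Lam tN
          (Rec · v0 · (Succ · (double_ · v1)) · Lam tN (Lam tN (double_ · v1))))).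

(* [next_aux_ · x · 0] is [x], and [next_aux_ · x · (j + 1)] is the sequence
   whose code is one more than that of [x], with [j] added to its first entry.
   Since [2 ^ (a + 1) * (2 m + 1) + 1 = 2 * (2 ^ a * (2 m + 1)) + 1] and
   [(2 m + 1) + 1 = 2 * (m + 1)], it sends, for [j + 1],
     - the empty sequence to [j];
     - [0] followed by [x] to [next_aux_ · x · (j + 2)];
     - [a + 1] followed by [x] to [j, a] followed by [x]. *)
Definition next_aux_ {V} : tm V (tSeq tN ~> tN ~> tSeq tN) :=
  Lam (tSeq tN)
    (LRec · v0
      · Lam tN (cond_ · v0 · Nil · (Cons · (pred_ · v0) · Nil))
      · Lam (tN ~> tSeq tN) (Lam tN (Lam tN
          (cond_ · v0
            · (Cons · v1 · (v2 · Zero))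
            · (cond_ · v1
                · (v2 · (Succ · v0))
                · (Cons · (pred_ · v0) · (Cons · (pred_ · v1) · (v2 · Zero)))))))).

Definition decode_ {V} : tm V (tN ~> tSeq tN) :=
  Lam tN (Rec · v0 · Nil · Lam (tSeq tN) (Lam tN (next_aux_ · v1 · (Succ · Zero)))).

(* [sinit s m] and [finit f m] are the initial segments of length [m] of a finite
   and of an infinite sequence. *)
Definition slen V (s : tm V tN) : tm V tN := len_ · (decode_ · s).
Definition sing V (n : tm V tN) : tm V tN := code_ · (Cons · n · Nil).
Definition scat V (s t : tm V tN) : tm V tN :=
  code_ · (append_ · (decode_ · s) · (decode_ · t)).
Definition sinit V (s m : tm V tN) : tm V tN := code_ · (take_ · (decode_ · s) · m).
Definition finit V (f : tm V T1) (m : tm V tN) : tm V tN := code_ · (tab_ · f · m).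

(* The finite sequence [s] followed by the infinite sequence [f]. *)
Definition sfcat V (s : tm V tN) (f : tm V T1) : tm V T1 :=
  Lam tN (cond_ · (monus_ · (Succ · v0) · slen (lift s))
            · (nth_ · (decode_ · lift s) · v0)
            · (lift f · (monus_ · v0 · slen (lift s)))).

Definition zeros {V} : tm V T1 := Lam tN Zero.
Definition ones {V} : tm V T1 := Lam tN (Succ · Zero).

Definition Prefix V (s t : tm V tN) : fm V := Ex tN (Eq (scat (lift s) v0) (lift t)).
Definition Pos V (n : tm V tN) : fm V := Lt Zero n.

Notation "s ⌢ t" := (scat s t) (at level 41, left associativity).

Definition InC V (g : tm V T1) : fm V :=
  And
    (* beta = v1, k = v0 *)
    (All T1 (Ex tN (Pos (lift (lift g) · finit v1 v0))))
    (* sigma = v2, tau = v1, n = v0 *)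
    (All tN (All tN (All tN
      (Imp (And (Prefix v2 v1) (Pos (lift (lift (lift g)) · sinit v2 v0)))
           (Eq (lift (lift (lift g)) · v2) (lift (lift (lift g)) · v1)))))).

Definition Value V (g a : tm V T1) (v : tm V tN) : fm V :=
  Ex tN (And (Pos (lift g · finit (lift a) v0))
             (Eq (lift v) (monus_ · (lift g · finit (lift a) v0) · (Succ · Zero)))).

Notation TGH := (T1 ~> tN ~> tN).

Definition GH V (G : tm V TGH) (g : tm V T1) (s : tm V tN) : fm V :=
  Value g
    (sfcat (s ⌢ sing Zero)
       (Lam tN (lift G · lift g · (lift s ⌢ sing (Succ · v0)))))
    (G · g · s).

(* [H] satisfies the recursion equations that define [fun s M => H^ (g, s, M)].
   For an associate [g] there is exactly one such [H], up to extensional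
   equality; its existence uses a choice function for [g]. *)
Definition IsHhat V (g : tm V T1) (H : tm V (tN ~> tN ~> tN)) : fm V :=
  All tN (All tN
    (let g' := lift (lift g) in
     let H' := lift (lift H) in
     let s := v1 in
     let M := v0 in
     And
       (Imp (Le M (slen s)) (Value g' (sfcat (sinit s M) ones) (H' · s · M)))
       (Imp (Neg (Le M (slen s)))
            (Value g'
               (sfcat (s ⌢ sing Zero
                         ⌢ finit (Lam tN (lift H' · (lift s ⌢ sing (Succ · v0)) · lift M)) M)
                      zeros)
               (H' · s · M))))).

(* [H^ (g, s, M) = v].  As [H] is determined by [g], quantifying it universally
   or existentially makes no difference over [P_QFAC10] when [g] is in C. *)
Definition HhatEq V (g : tm V T1) (s M v : tm V tN) : fm V :=
  All (tN ~> tN ~> tN)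
    (Imp (IsHhat (lift g) v0) (Eq (v0 · lift s · lift M) (lift v))).

Definition GH_ns : fm no_var :=
  ExSt TGH
    (And
       (* Gamma = v2, gamma = v1, s = v0 *)
       (AllSt T1 (Imp (InC v0) (All tN (GH v2 v1 v0))))
       (* Gamma = v3, gamma = v2, s = v1, N = v0 *)
       (AllSt T1 (Imp (InC v0)
          (AllSt tN (All tN
             (Imp (Neg (St v0)) (HhatEq v2 v1 v0 (v3 · v2 · v1)))))))).

Definition Pi01_TRANS : fm no_var :=
  AllSt T1
    (Imp (AllSt tN (Eq (v1 · v0) Zero)) (All tN (Eq (v1 · v0) Zero))).

(* Main.v *)
(* Suppose [f] is standard and vanishes at all standard arguments, but [f m <> 0] for some
   [m].  Let [gamma s] be [i + 1] for the least [i < |s|] with [f i <> 0], and [0] if there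
   is none.  As the search succeeds on sequences longer than [m], [gamma] is an associate
   of a constant functional, and it is standard because [f] is.  Now [Gamma gamma <>] is
   standard, being built from standard objects, yet by GH it is a value of [gamma], so [f]
   does not vanish there. *)
From Stdlib Require Import List Setoid Morphisms.
Require Import Defs.
Import ListNotations.

Set Implicit Arguments.
Unset Strict Implicit.

(** * Substitution *)

(** Substitutions are functions; comparing them pointwise takes the place of functional
    extensionality in the binder cases below. *)
Lemma sub_ext V t (u : tm V t) : forall W (f g : substitution V W),
  (forall s x, f s x = g s x) -> sub f u = sub g u.
Proof.
induction u; intros W f g fg; simpl; f_equal; auto.
apply IHu; intros r x; destruct x; simpl; rewrite ?fg; reflexivity.
Qed.

Lemma ren_sub V t (u : tm V t) : forall W (r : renaming V W),
  ren r u = sub (fun s x => Var (r s x)) u.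
Proof.
induction u; intros W r; simpl; f_equal; auto.
rewrite IHu; apply sub_ext; intros s' x; destruct x; reflexivity.
Qed.

Lemma sub_ren V t (u : tm V t) : forall W X (r : renaming V W) (f : substitution W X),
  sub f (ren r u) = sub (fun s x => f s (r s x)) u.
Proof.
induction u; intros W X r f; simpl; f_equal; auto.
rewrite IHu; apply sub_ext; intros s' x; destruct x; reflexivity.
Qed.

Lemma ren_ren V W X t (u : tm V t) (r : renaming V W) (f : renaming W X) :
  ren f (ren r u) = ren (fun s x => f s (r s x)) u.
Proof. now rewrite ren_sub, sub_ren, ren_sub. Qed.

Lemma ren_up_shift V W s t (u : tm V t) (r : renaming V W) :
  ren (up_ren s r) (ren (shift s) u) = ren (shift s) (ren r u).
Proof. now rewrite !ren_ren. Qed.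

(** [up_sub] shifts the terms that it carries under a binder, so the binder case comes down to the
    commutation of two renamings. The composition of substitutions then builds on this mixed law. *)
Lemma ren_after_sub V t (u : tm V t) :
  forall W X (f : substitution V W) (r : renaming W X),
  ren r (sub f u) = sub (fun s x => ren r (f s x)) u.
Proof.
induction u; intros W X f r; simpl; f_equal; auto.
rewrite IHu; apply sub_ext; intros s' x; destruct x; simpl; auto.
apply ren_up_shift.
Qed.

Lemma sub_up_shift V W s t (u : tm V t) (f : substitution V W) :
  sub (up_sub s f) (ren (shift s) u) = ren (shift s) (sub f u).
Proof. now rewrite sub_ren, ren_after_sub. Qed.

Lemma sub_sub V t (u : tm V t) :
  forall W X (f : substitution V W) (g : substitution W X),
  sub g (sub f u) = sub (fun s x => sub g (f s x)) u.
Proof.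
induction u; intros W X f g; simpl; f_equal; auto.
rewrite IHu; apply sub_ext; intros s' x; destruct x; simpl; auto.
apply sub_up_shift.
Qed.

Lemma sub_ids V t (u : tm V t) : sub (@ids V) u = u.
Proof.
induction u; simpl; f_equal; auto.
rewrite <- IHu at 2; apply sub_ext; intros s' x; destruct x; reflexivity.
Qed.

Lemma sub_scons_shift V W s t (u : tm V t) (w : tm W s) (f : substitution V W) :
  sub (scons w f) (ren (shift s) u) = sub f u.
Proof. now rewrite sub_ren. Qed.

Lemma sub_weaken V s t (u : tm V t) : sub (fun r x => Var (@ES V s r x)) u = ren (shift s) u.
Proof. symmetry; apply ren_sub. Qed.

Lemma sub_weaken2 V r s t (u : tm V t) :
  sub (fun q x => Var (@ES (ext V r) s q (ES x))) u = ren (shift s) (ren (shift r) u).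
Proof. symmetry; now rewrite ren_ren, ren_sub. Qed.

Lemma fsub_ext V (p : fm V) : forall W (f g : substitution V W),
  (forall s x, f s x = g s x) -> fsub f p = fsub g p.
Proof.
induction p; intros W f g fg; simpl; f_equal; eauto using sub_ext;
apply IHp; intros r x; destruct x; simpl; rewrite ?fg; reflexivity.
Qed.

Lemma fren_fsub V (p : fm V) : forall W (r : renaming V W),
  fren r p = fsub (fun s x => Var (r s x)) p.
Proof.
induction p; intros W r; simpl; f_equal; auto using ren_sub;
rewrite IHp; apply fsub_ext; intros s' x; destruct x; reflexivity.
Qed.

Lemma fsub_fsub V (p : fm V) :
  forall W X (f : substitution V W) (g : substitution W X),
  fsub g (fsub f p) = fsub (fun s x => sub g (f s x)) p.
Proof.
induction p; intros W X f g; simpl; f_equal; auto using sub_sub;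
rewrite IHp; apply fsub_ext; intros s' x; destruct x; simpl; auto; apply sub_up_shift.
Qed.

Lemma fsub_ids V (p : fm V) : fsub (@ids V) p = p.
Proof.
induction p; simpl; f_equal; auto using sub_ids;
rewrite <- IHp at 2; apply fsub_ext; intros s' x; destruct x; reflexivity.
Qed.

Lemma internal_fsub V (p : fm V) : forall W (f : substitution V W),
  internal p -> internal (fsub f p).
Proof. induction p; simpl; intros; intuition. Qed.

Lemma sub_Var (V W : scope) (f : substitution V W) t (x : V t) : sub f (Var x) = f t x.
Proof. reflexivity. Qed.
Lemma sub_App V W (f : substitution V W) s t (u : tm V (s ~> t)) v :
  sub f (u · v) = sub f u · sub f v.
Proof. reflexivity. Qed.
Lemma sub_Lam V W (f : substitution V W) s t (b : tm (ext V s) t) :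
  sub f (Lam s b) = Lam s (sub (up_sub s f) b).
Proof. reflexivity. Qed.
Lemma ren_Var (V W : scope) (f : renaming V W) t (x : V t) : ren f (Var x) = Var (f t x).
Proof. reflexivity. Qed.
Lemma ren_App V W (f : renaming V W) s t (u : tm V (s ~> t)) v :
  ren f (u · v) = ren f u · ren f v.
Proof. reflexivity. Qed.
Lemma ren_Lam V W (f : renaming V W) s t (b : tm (ext V s) t) :
  ren f (Lam s b) = Lam s (ren (up_ren s f) b).
Proof. reflexivity. Qed.

Lemma sub_succ_shift V t (u : tm V t) :
  sub (@succ_var V) (ren (shift tN) u) = ren (shift tN) u.
Proof. unfold succ_var; rewrite sub_scons_shift; apply sub_weaken. Qed.

Lemma shiftE (V : scope) s t (x : V t) : shift s t x = ES x.
Proof. reflexivity. Qed.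

#[local] Hint Rewrite shiftE sub_Var sub_App sub_Lam ren_Var ren_App ren_Lam
  ren_up_shift sub_up_shift sub_ids sub_scons_shift sub_weaken sub_weaken2 sub_succ_shift : subst.

(** Serves the step of [seq_induction], whose two fresh variables are the head [v1] and the tail
    [v0]. *)
Definition under2_inst V r s t (w : tm (ext (ext V r) s) t) (p : fm (ext V t)) :
  fm (ext (ext V r) s) := fsub (scons w (fun q y => Var (ES (ES y)))) p.

(* A closed constant is polymorphic in its scope, so that renaming or substituting
   in it only changes the scope argument. *)
Ltac fold_closed :=
  match goal with
  | |- context [@sub ?V ?W ?f ?t ?c] =>
      let F := eval pattern V in c in
      match F with ?F' _ => let c' := eval cbv beta in (F' W) in
        change (@sub V W f t c) with c' end
  | |- context [@ren ?V ?W ?f ?t ?c] =>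
      let F := eval pattern V in c in
      match F with ?F' _ => let c' := eval cbv beta in (F' W) in
        change (@ren V W f t c) with c' end
  end.

Ltac simp :=
  repeat (unfold inst, flift, lift, under2_inst, Neg, Pos, Lt, Le;
          cbn [fsub fren map scons up_sub up_ren shift ids succ_var sub ren];
          autorewrite with subst; repeat fold_closed).

(** * Derived rules *)

Notation "G ⊢ p" := (@derives P_QFAC10 _ G p) (at level 70).

Lemma epa V (G : list (fm V)) p : EPA_axiom p -> G ⊢ p.
Proof. intro h; apply d_ax, PQ_P, P_EPA, h. Qed.

(* A constant, so that setoid rewriting recognises provable equality as a relation. *)
Definition eqv V (G : list (fm V)) t (u v : tm V t) : Prop := G ⊢ Eq u v.
Arguments eqv {V} G {t} u v.
Notation "u ≈[ G ] v" := (eqv G u v) (at level 70).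

Lemma leibniz V (G : list (fm V)) t (u v : tm V t) p :
  internal p -> G ⊢ Eq u v -> G ⊢ inst u p -> G ⊢ inst v p.
Proof.
intros ip uv pu; eapply d_impE, pu; eapply d_impE, uv; now apply epa, ax_leibniz.
Qed.

Global Instance eqv_equivalence V (G : list (fm V)) t : Equivalence (@eqv V G t).
Proof.
assert (sy : Symmetric (@eqv V G t)).
{ intros u v uv.
  assert (h := leibniz (p := Eq v0 (lift u)) I uv); revert h; simp; intro h.
  apply h, epa, ax_refl. }
split; auto.
- intro u; apply epa, ax_refl.
- intros u v w uv vw.
  assert (h := leibniz (p := Eq (lift u) v0) I vw); revert h; simp; intro h; exact (h uv).
Qed.

Global Instance App_proper V (G : list (fm V)) (s t : ty) :
  Proper (eqv G ==> eqv G ==> eqv G) (@App V s t).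
Proof.
intros f g fg u v uv; transitivity (g · u).
- assert (h := leibniz (p := Eq (lift f · lift u) (v0 · lift u)) I fg); revert h; simp.
  intro h; apply h, epa, ax_refl.
- assert (h := leibniz (p := Eq (lift g · lift u) (lift g · v0)) I uv); revert h; simp.
  intro h; apply h, epa, ax_refl.
Qed.

Lemma beta V (G : list (fm V)) s t (b : tm (ext V s) t) u :
  Lam s b · u ≈[G] sub (scons u (@ids V)) b.
Proof. apply epa, ax_beta. Qed.

Lemma rec0 V (G : list (fm V)) t (a : tm V t) b : Rec · Zero · a · b ≈[G] a.
Proof. apply epa, ax_rec0. Qed.

Lemma recS V (G : list (fm V)) t n (a : tm V t) b :
  Rec · (Succ · n) · a · b ≈[G] b · (Rec · n · a · b) · n.
Proof. apply epa, ax_recS. Qed.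

Lemma lrec_nil V (G : list (fm V)) s t (a : tm V t) (b : tm V (t ~> s ~> t)) :
  LRec · Nil · a · b ≈[G] a.
Proof. apply epa, ax_lrec_nil. Qed.

Lemma lrec_cons V (G : list (fm V)) s t (h : tm V s) x (a : tm V t) b :
  LRec · (Cons · h · x) · a · b ≈[G] b · (LRec · x · a · b) · h.
Proof. apply epa, ax_lrec_cons. Qed.

Ltac beta_simp :=
  repeat (match goal with
          | |- @eqv ?V ?G _ ?l ?r =>
              match constr:((l, r)) with
              | context [@App V _ _ (Lam ?s ?b) ?u] => rewrite (beta G b u)
              end
          end; simp).
Ltac eqn := match goal with |- derives _ ?G (Eq ?u ?v) => change (u ≈[G] v) end.
Ltac as_eqv H :=
  try match type of H with derives _ ?G (Eq ?u ?v) => change (u ≈[G] v) in H end.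
Ltac hyp := apply d_hyp; cbn; auto 10.
(** Hypotheses of the object calculus are addressed by position, 0 being the most recent. *)
Ltac fetch n H :=
  let get G :=
    let p := eval cbn [nth] in (nth n G Bot) in
    assert (H : G ⊢ p) by hyp in
  match goal with
  | |- derives _ ?G _ => get G
  | |- eqv ?G _ _ => get G
  end; as_eqv H.
Ltac top H := fetch 0 H.
(* Hides the hypotheses, in which setoid rewriting could not rewrite. *)
Ltac abstract_context :=
  let gen G := let D := fresh "D" in set (D := G) in *; clearbody D in
  match goal with
  | |- eqv ?G _ _ => gen G
  | |- derives _ ?G _ => gen G
  end.
Tactic Notation "spec" hyp(H) uconstr(w) :=
  let k := fresh in
  pose proof (@d_allE _ _ _ _ _ w H) as k; clear H; rename k into H;
  revert H; simp; intro H; as_eqv H.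

Lemma inst_v0_shift V s (p : fm (ext V s)) :
  inst v0 (fren (up_ren s (shift s)) p) = p.
Proof.
unfold inst; rewrite fren_fsub, fsub_fsub.
rewrite <- fsub_ids; apply fsub_ext; intros t x; destruct x; reflexivity.
Qed.

(** Opens a quantified hypothesis at the variable just introduced, where [d_allE] alone would leave
    a shift followed by a substitution. *)
Lemma all_v0 V s (G : list (fm (ext V s))) (p : fm (ext V s)) :
  G ⊢ flift (All s p) -> G ⊢ p.
Proof. intro h; rewrite <- inst_v0_shift; apply d_allE, h. Qed.

(** * Induction and case distinction on numbers and sequences *)

Lemma nat_induction V (G : list (fm V)) (p : fm (ext V tN)) n :
  internal p -> G ⊢ inst Zero p -> (p :: map (flift (s := tN)) G) ⊢ fsub (@succ_var V) p ->
  G ⊢ inst n p.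
Proof.
intros ip p0 pS; apply d_allE.
eapply d_impE; [eapply d_impE; [now apply epa, ax_induction | exact p0]|].
apply d_allI, d_impI, pS.
Qed.

Ltac nat_ind p n :=
  let h := fresh in
  assert (h := fun G => @nat_induction _ G p n); revert h; simp; intro h; apply h; clear h;
  [ cbn; tauto | try eqn | try eqn ].

(** Induction is applied only to the internal statement that [n] is zero or a successor, so [q]
    itself may be external. *)
Lemma nat_cases V (G : list (fm V)) n q :
  (Eq n Zero :: G) ⊢ q ->
  (Eq (lift n) (Succ · v0) :: map (flift (s := tN)) G) ⊢ flift q -> G ⊢ q.
Proof.
intros q0 qS.
assert (c : G ⊢ Or (Eq n Zero) (Ex tN (Eq (lift n) (Succ · v0)))).
{ nat_ind (Or (Eq v0 Zero) (Ex tN (Eq v1 (Succ · v0))) : fm (ext V tN)) n.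
  - apply d_orI1, epa, ax_refl.
  - apply d_orI2. apply d_exI with (u := v0). simp. apply epa, ax_refl. }
(* There is no weakening rule: the premises enter the case distinction by cuts. *)
apply d_impE with (p := Imp (Eq n Zero) q); [|now apply d_impI].
apply d_impE with (p := All tN (Imp (Eq (lift n) (Succ · v0)) (flift q)));
  [|now apply d_allI, d_impI].
apply d_impE with (p := Or (Eq n Zero) (Ex tN (Eq (lift n) (Succ · v0)))); [|exact c].
do 3 apply d_impI.
eapply d_orE; [hyp | eapply d_impE; hyp |].
eapply d_exE; [hyp |].
apply d_impE with (p := Eq (lift n) (Succ · v0)); [apply all_v0|]; hyp.
Qed.

Lemma bot_elim V (G : list (fm V)) p : G ⊢ Bot -> G ⊢ p.
Proof.
intro h; apply d_dne, d_impE with (p := Bot); [|exact h].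
apply d_impI, d_impI; hyp.
Qed.

Lemma absurd_S V (G : list (fm V)) n p : G ⊢ Eq (Succ · n) Zero -> G ⊢ p.
Proof.
intro h; apply bot_elim; apply d_impE with (2 := h); apply epa, ax_succ_neq0.
Qed.

Lemma succ_inj V (G : list (fm V)) m n : Succ · m ≈[G] Succ · n -> m ≈[G] n.
Proof. intro h; apply d_impE with (2 := h); apply epa, ax_succ_inj. Qed.

(** The two sides are instances of one formula reached by different renamings and substitutions;
    after composing these, it remains to compare them on each variable. *)
Ltac same_instance :=
  unfold inst, flift, under2_inst; cbn [fren fsub];
  repeat match goal with
         | |- All _ _ = All _ _ => f_equal
         | |- Imp _ _ = Imp _ _ => f_equal
         | |- Eq _ _ = Eq _ _ => simp; reflexivity
         end;
  rewrite ?fren_fsub, ?fsub_fsub;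
  match goal with
  | |- fsub _ _ = fsub _ _ => idtac
  | |- fsub _ ?p = ?p => rewrite <- fsub_ids
  | |- ?p = fsub _ ?p => symmetry; rewrite <- fsub_ids
  end;
  apply fsub_ext; intros ? []; reflexivity.
Ltac convert_from H :=
  match type of H with derives _ _ ?p =>
  match goal with |- derives _ _ ?q => replace q with p; [exact H|] end end.

Lemma len_nil V (G : list (fm V)) s : len_ · @Nil V s ≈[G] Zero.
Proof. unfold len_. beta_simp. apply lrec_nil. Qed.

Lemma len_cons V (G : list (fm V)) s (h : tm V s) x :
  len_ · (Cons · h · x) ≈[G] Succ · (len_ · x).
Proof. unfold len_. beta_simp. rewrite lrec_cons. beta_simp. reflexivity. Qed.

(* Sequences come only with case distinction, so the induction is on the length. *)
Lemma seq_induction V (G : list (fm V)) s (p : fm (ext V (tSeq s))) x :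
  internal p -> G ⊢ inst Nil p ->
  (under2_inst v0 p :: map (flift (s := tSeq s)) (map (flift (s := s)) G))
    ⊢ under2_inst (Cons · v1 · v0) p ->
  G ⊢ inst x p.
Proof.
intros ip pn pc.
assert (ir : forall W (r : renaming _ W), internal (fren r p)).
{ intros W r; rewrite fren_fsub; now apply internal_fsub. }
(* [A] and [B] express the two premises as single formulas over [V]; cuts make them hypotheses of
   the induction on the length, where their lifted forms remain available. *)
pose (A := inst Nil p).
pose (B := All s (All (tSeq s) (Imp (under2_inst v0 p) (under2_inst (Cons · v1 · v0) p)))).
(* All sequences of the given length are treated at once, because the step passes from a sequence to
   its tail. *)
pose (q := All (tSeq s) (Imp (Eq (len_ · v0) v1) (fren (up_ren (tSeq s) (shift tN)) p))).
assert (pB : G ⊢ B) by now apply d_allI, d_allI, d_impI.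
assert (pq : G ⊢ inst (len_ · x) q).
{ apply d_impE with (2 := pn), d_impE with (2 := pB), d_impI, d_impI.
  apply nat_induction.
  - cbn; auto.
  - replace (inst Zero q) with (All (tSeq s) (Imp (Eq (len_ · v0) Zero) p)).
    2: { unfold q. same_instance. }
    apply d_allI, d_impI. eapply d_orE; [apply epa, (ax_seq_cases v0)| |].
    + rewrite <- (inst_v0_shift p) at 2. apply leibniz with (u := Nil); auto.
      * apply (symmetry (R := eqv _)). hyp.
      * assert (h : (Eq v0 Nil :: Eq (len_ · v0) Zero
                       :: map (flift (s := tSeq s)) (A :: B :: G)) ⊢ flift A) by hyp.
        convert_from h. unfold A. same_instance.
    + do 2 (eapply d_exE; [apply d_hyp; left; reflexivity|]).
      apply absurd_S with (n := len_ · v0).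
      apply (symmetry (R := eqv _)).
      match goal with |- eqv ?G _ _ =>
       assert (h1 : Zero ≈[G] len_ · v2) by (symmetry; hyp);
       assert (h2 : v2 ≈[G] Cons · v1 · v0) by hyp end.
      abstract_context. rewrite h1, h2. apply len_cons.
  - replace (fsub (@succ_var V) q) with (All (tSeq s) (Imp (Eq (len_ · v0) (Succ · v1))
      (fren (up_ren (tSeq s) (shift tN)) p))).
    2: { unfold q. same_instance. }
    apply d_allI, d_impI. eapply d_orE; [apply epa, (ax_seq_cases v0)| |].
    + apply absurd_S with (n := v1).
      match goal with |- derives _ ?G _ =>
       assert (h1 : Succ · v1 ≈[G] len_ · v0) by (symmetry; hyp);
       assert (h2 : v0 ≈[G] Nil) by hyp end.
      eqn. abstract_context. rewrite h1, h2. apply len_nil.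
    + do 2 (eapply d_exE; [apply d_hyp; left; reflexivity|]).
      match goal with |- derives _ ?G _ =>
       assert (h1 : len_ · v2 ≈[G] Succ · v3) by hyp;
       assert (h2 : v2 ≈[G] Cons · v1 · v0) by hyp;
       assert (h3 : G ⊢ flift (flift (flift q))) by hyp;
       assert (h4 : G ⊢ flift (flift (flift (flift B)))) by hyp
      end.
      abstract_context.
      (* Here [v3] is the length, [v2] the sequence, [v1] its head and [v0] its tail. [P] gives the
         instances of [p] a common form in which they can be chained. *)
      pose (P w := fsub (scons w (fun t y => Var (ES (ES (ES (ES y)))))) p
        : fm (ext (ext (ext (ext V tN) (tSeq s)) s) (tSeq s))).
      assert (k : D ⊢ P v2).
      2: { convert_from k. unfold P. same_instance. }
      assert (k3 : D ⊢ Imp (Eq (len_ · v0) v3) (P v0)).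
      { apply d_allE with (u := v0) in h3. convert_from h3. unfold P. same_instance. }
      assert (k4 : D ⊢ Imp (P v0) (P (Cons · v1 · v0))).
      { apply d_allE with (u := v1) in h4. unfold inst, flift, B in h4; cbn [fren fsub] in h4.
        apply d_allE with (u := v0) in h4. convert_from h4.
        unfold P. same_instance. }
      assert (k0 : D ⊢ P (Cons · v1 · v0)).
      { apply d_impE with (1 := k4), d_impE with (1 := k3).
        apply succ_inj; rewrite <- h1, h2; symmetry; apply len_cons. }
      assert (k1 : D ⊢ inst (Cons · v1 · v0)
                         (fren (up_ren _ (fun t y => ES (ES (ES (ES y))))) p)).
      { convert_from k0. unfold P. same_instance. }
      apply leibniz with (v := v2) in k1; [ | apply ir | exact (symmetry h2)].
      convert_from k1. unfold P. same_instance.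
    }
(* The length was chosen as that of [x], so the remaining premise is reflexivity. *)
apply d_allE with (u := x) in pq.
apply d_impE with (p := Eq (len_ · x) (len_ · x)).
2: apply epa, ax_refl.
convert_from pq. unfold q. same_instance.
Qed.

Ltac seq_ind p x :=
  let h := fresh in
  assert (h := fun G => @seq_induction _ G tN p x); revert h; simp; intro h; apply h; clear h;
  [ cbn; tauto | try eqn | try eqn ].

(** * Arithmetic and number sequences *)

Lemma plus_0 V (G : list (fm V)) u : plus_ · u · Zero ≈[G] u.
Proof. unfold plus_. beta_simp. apply rec0. Qed.

Lemma plus_S V (G : list (fm V)) u v : plus_ · u · (Succ · v) ≈[G] Succ · (plus_ · u · v).
Proof. unfold plus_. beta_simp. rewrite recS. beta_simp. reflexivity. Qed.

Lemma plus_S_l V (G : list (fm V)) u v : plus_ · (Succ · u) · v ≈[G] Succ · (plus_ · u · v).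
Proof.
nat_ind (Eq (plus_ · (Succ · lift u) · v0) (Succ · (plus_ · lift u · v0))) v.
- rewrite !plus_0; reflexivity.
- top IH. abstract_context. rewrite !plus_S, IH. reflexivity.
Qed.

Lemma pred_0 V (G : list (fm V)) : pred_ · Zero ≈[G] Zero.
Proof. unfold pred_. beta_simp. apply rec0. Qed.

Lemma pred_S V (G : list (fm V)) u : pred_ · (Succ · u) ≈[G] u.
Proof. unfold pred_. beta_simp. rewrite recS. beta_simp. reflexivity. Qed.

Lemma monus_0 V (G : list (fm V)) u : monus_ · u · Zero ≈[G] u.
Proof. unfold monus_. beta_simp. apply rec0. Qed.

Lemma monus_S V (G : list (fm V)) u v :
  monus_ · u · (Succ · v) ≈[G] pred_ · (monus_ · u · v).
Proof. unfold monus_. beta_simp. rewrite recS. beta_simp. reflexivity. Qed.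

Lemma cond_0 V (G : list (fm V)) t (a b : tm V t) : cond_ · Zero · a · b ≈[G] a.
Proof. unfold cond_. beta_simp. apply rec0. Qed.

Lemma cond_S V (G : list (fm V)) t n (a b : tm V t) : cond_ · (Succ · n) · a · b ≈[G] b.
Proof. unfold cond_. beta_simp. rewrite recS. beta_simp. reflexivity. Qed.

Lemma append_nil V (G : list (fm V)) s (y : tm V (tSeq s)) : append_ · Nil · y ≈[G] y.
Proof. unfold append_. beta_simp. apply lrec_nil. Qed.

Lemma append_cons V (G : list (fm V)) s (h : tm V s) x y :
  append_ · (Cons · h · x) · y ≈[G] Cons · h · (append_ · x · y).
Proof. unfold append_. beta_simp. rewrite lrec_cons. beta_simp. reflexivity. Qed.

Lemma tab_0 V (G : list (fm V)) s (f : tm V (tN ~> s)) : tab_ · f · Zero ≈[G] Nil.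
Proof. unfold tab_. beta_simp. apply rec0. Qed.

Lemma tab_S V (G : list (fm V)) s (f : tm V (tN ~> s)) n :
  tab_ · f · (Succ · n) ≈[G] append_ · (tab_ · f · n) · (Cons · (f · n) · Nil).
Proof. unfold tab_. beta_simp. rewrite recS. beta_simp. reflexivity. Qed.

Lemma take_tab V (G : list (fm V)) x n :
  take_ · x · n ≈[G] tab_ · (@nth_ V tN · x) · (monus_ · n · (monus_ · n · (len_ · x))).
Proof. unfold take_. beta_simp. reflexivity. Qed.

(** * Decoding inverts coding *)

Lemma decode_0 V (G : list (fm V)) : decode_ · Zero ≈[G] Nil.
Proof. unfold decode_. beta_simp. apply rec0. Qed.

Lemma decode_S V (G : list (fm V)) n :
  decode_ · (Succ · n) ≈[G] next_aux_ · (decode_ · n) · (Succ · Zero).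
Proof. unfold decode_. beta_simp. rewrite recS. beta_simp. reflexivity. Qed.

Lemma double_0 V (G : list (fm V)) : double_ · Zero ≈[G] Zero.
Proof. unfold double_. beta_simp. apply plus_0. Qed.

Lemma double_S V (G : list (fm V)) n :
  double_ · (Succ · n) ≈[G] Succ · (Succ · (double_ · n)).
Proof. unfold double_. beta_simp. rewrite plus_S, plus_S_l. reflexivity. Qed.

Lemma next_nil_0 V (G : list (fm V)) : next_aux_ · Nil · Zero ≈[G] Nil.
Proof. unfold next_aux_. beta_simp. rewrite lrec_nil. beta_simp. apply cond_0. Qed.

Lemma next_nil_S V (G : list (fm V)) j : next_aux_ · Nil · (Succ · j) ≈[G] Cons · j · Nil.
Proof.
unfold next_aux_. beta_simp. rewrite lrec_nil. beta_simp. rewrite cond_S, pred_S. reflexivity.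
Qed.

Lemma next_cons_0 V (G : list (fm V)) a x :
  next_aux_ · (Cons · a · x) · Zero ≈[G] Cons · a · (next_aux_ · x · Zero).
Proof.
unfold next_aux_. beta_simp. rewrite lrec_cons. beta_simp. rewrite cond_0. reflexivity.
Qed.

Lemma next_cons_0S V (G : list (fm V)) x j :
  next_aux_ · (Cons · Zero · x) · (Succ · j) ≈[G] next_aux_ · x · (Succ · (Succ · j)).
Proof.
unfold next_aux_. beta_simp. rewrite lrec_cons. beta_simp. rewrite cond_S, cond_0. reflexivity.
Qed.

Lemma next_cons_SS V (G : list (fm V)) a x j :
  next_aux_ · (Cons · (Succ · a) · x) · (Succ · j) ≈[G]
  Cons · j · (Cons · a · (next_aux_ · x · Zero)).
Proof.
unfold next_aux_. beta_simp. rewrite lrec_cons. beta_simp.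
rewrite cond_S, cond_S, !pred_S. reflexivity.
Qed.

Lemma plus_0_l V (G : list (fm V)) u : plus_ · Zero · u ≈[G] u.
Proof.
nat_ind (Eq (plus_ · Zero · v0) v0 : fm (ext V tN)) u.
- apply plus_0.
- top IH. abstract_context. rewrite plus_S, IH. reflexivity.
Qed.

Lemma next_0 V (G : list (fm V)) x : next_aux_ · x · Zero ≈[G] x.
Proof.
seq_ind (Eq (next_aux_ · v0 · Zero) v0 : fm (ext V (tSeq tN))) x.
- apply next_nil_0.
- top IH. abstract_context. rewrite next_cons_0, IH. reflexivity.
Qed.

(** The inner sequence has a positive head, so its code is an even number [2 k]. The code [2 k + 1]
    that follows has head 0, raised here to [j], and a tail of code [k], which is the inner sequence
    with its head lowered by one. *)
Lemma next_next V (G : list (fm V)) x i j :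
  next_aux_ · (next_aux_ · x · (Succ · (Succ · i))) · (Succ · j) ≈[G]
  Cons · j · (next_aux_ · x · (Succ · i)).
Proof.
(* [i] has to vary: a head 0 carries the increment into the tail with an offset larger by one. *)
assert (h : G ⊢ All tN (All tN
  (Eq (next_aux_ · (next_aux_ · lift (lift x) · (Succ · (Succ · v1))) · (Succ · v0))
     (Cons · v0 · (next_aux_ · lift (lift x) · (Succ · v1)))))).
{ seq_ind (All tN (All tN
    (Eq (next_aux_ · (next_aux_ · v2 · (Succ · (Succ · v1))) · (Succ · v0))
       (Cons · v0 · (next_aux_ · v2 · (Succ · v1))))) : fm (ext V (tSeq tN))) x.
  - apply d_allI, d_allI. eqn.
    rewrite !next_nil_S, next_cons_SS, next_nil_0; reflexivity.
  - apply d_allI, d_allI, nat_cases with (n := v3); simp.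
    + top hz.
      fetch 1 IH. spec IH (Succ · v1). spec IH v0.
      eqn. abstract_context. rewrite hz, !next_cons_0S. exact IH.
    + top hs. eqn. abstract_context.
      rewrite hs, !next_cons_SS, !next_cons_0, !next_0. reflexivity. }
spec h i. spec h j. exact h.
Qed.

(** This is [2 ^ a * n]. *)
Definition shl_ {V} : tm V (tN ~> tN ~> tN) :=
  Lam tN (Lam tN (Rec · v1 · v0 · Lam tN (Lam tN (double_ · v1)))).

(* [pshl_ · a · m] is [2 ^ a * (2 m + 1) - 1], the predecessor of the code of a sequence
   with head [a] whose tail has code [m]. *)
Definition pshl_ {V} : tm V (tN ~> tN ~> tN) :=
  Lam tN (Lam tN (Rec · v1 · (double_ · v0) · Lam tN (Lam tN (Succ · (double_ · v1))))).

Lemma shl_0 V (G : list (fm V)) n : shl_ · Zero · n ≈[G] n.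
Proof. unfold shl_. beta_simp. apply rec0. Qed.

Lemma shl_S V (G : list (fm V)) a n : shl_ · (Succ · a) · n ≈[G] double_ · (shl_ · a · n).
Proof. unfold shl_. beta_simp. rewrite recS. beta_simp. reflexivity. Qed.

Lemma pshl_0 V (G : list (fm V)) n : pshl_ · Zero · n ≈[G] double_ · n.
Proof. unfold pshl_. beta_simp. apply rec0. Qed.

Lemma pshl_S V (G : list (fm V)) a n :
  pshl_ · (Succ · a) · n ≈[G] Succ · (double_ · (pshl_ · a · n)).
Proof. unfold pshl_. beta_simp. rewrite recS. beta_simp. reflexivity. Qed.

Lemma code_nil V (G : list (fm V)) : code_ · Nil ≈[G] Zero.
Proof. unfold code_. beta_simp. apply lrec_nil. Qed.

Lemma code_cons V (G : list (fm V)) a x :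
  code_ · (Cons · a · x) ≈[G] shl_ · a · (Succ · (double_ · (code_ · x))).
Proof. unfold code_, shl_. beta_simp. rewrite lrec_cons. beta_simp. reflexivity. Qed.

(** Exhibits the code of a nonempty sequence as a successor, the form in which the recursion of
    [decode_] can unfold it. *)
Lemma S_pshl V (G : list (fm V)) a m :
  Succ · (pshl_ · a · m) ≈[G] shl_ · a · (Succ · (double_ · m)).
Proof.
nat_ind (Eq (Succ · (pshl_ · v0 · lift m)) (shl_ · v0 · (Succ · (double_ · lift m)))) a.
- rewrite pshl_0, shl_0; reflexivity.
- top IH. abstract_context. rewrite pshl_S, shl_S, <- IH, double_S. reflexivity.
Qed.

(** The number after [2 m] is [2 ^ 0 * (2 m + 1)], the code of head 0 and a tail of code [m]; the
    offset [j] is added to that head. *)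
Lemma next_decode_double V (G : list (fm V)) m j :
  next_aux_ · (decode_ · (double_ · m)) · (Succ · j) ≈[G] Cons · j · (decode_ · m).
Proof.
apply nat_cases with (n := m); simp; eqn.
- top hz. abstract_context. rewrite hz, double_0, decode_0, next_nil_S. reflexivity.
- top hs. abstract_context.
  (* Decoding [2 (k + 1)] takes two increments from [2 k], both with offset 0, so the induction
     concerns this offset only; a general [j] enters with the increment after them. *)
  assert (h : forall k, next_aux_ · (decode_ · (double_ · k)) · (Succ · Zero) ≈[D]
               Cons · Zero · (decode_ · k)).
  { intro k.
    nat_ind (Eq (next_aux_ · (decode_ · (double_ · v0)) · (Succ · Zero))
               (Cons · Zero · (decode_ · v0)) : fm (ext (ext V tN) tN)) k.
    - rewrite double_0, decode_0, next_nil_S. reflexivity.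
    - top IH. abstract_context.
      rewrite double_S, !decode_S, IH, next_cons_0S, next_next. reflexivity. }
  rewrite hs, double_S, !decode_S, h, next_cons_0S, next_next. reflexivity.
Qed.

(** One more than [pshl_ · a · m] is the code of head [a] and a tail of code [m]. The induction on
    [a] keeps [j] general, since each doubling trades one unit of [a] for one unit of offset. *)
Lemma next_decode_pshl V (G : list (fm V)) a m j :
  next_aux_ · (decode_ · (pshl_ · a · m)) · (Succ · j) ≈[G]
  Cons · (plus_ · a · j) · (decode_ · m).
Proof.
assert (h : G ⊢ All tN
  (Eq (next_aux_ · (decode_ · (pshl_ · lift a · lift m)) · (Succ · v0))
      (Cons · (plus_ · lift a · v0) · (decode_ · lift m)))).
{ nat_ind (All tN
    (Eq (next_aux_ · (decode_ · (pshl_ · v1 · lift (lift m))) · (Succ · v0))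
      (Cons · (plus_ · v1 · v0) · (decode_ · lift (lift m))))) a.
  - apply d_allI. eqn. rewrite pshl_0, next_decode_double, plus_0_l. reflexivity.
  - apply d_allI. simp. fetch 0 IH. spec IH (Succ · v0). eqn. abstract_context.
    rewrite pshl_S, decode_S, next_decode_double, next_cons_0S, IH, plus_S, plus_S_l.
    reflexivity. }
spec h j. exact h.
Qed.

(** With this, a function defined through [decode_] can be computed on codes; for the associate
    below, only the length of the coded sequence then matters. *)
Lemma decode_code V (G : list (fm V)) x : decode_ · (code_ · x) ≈[G] x.
Proof.
seq_ind (Eq (decode_ · (code_ · v0)) v0 : fm (ext V (tSeq tN))) x.
- rewrite code_nil. apply decode_0.
- top IH. abstract_context.
  rewrite code_cons, <- S_pshl, decode_S, next_decode_pshl, plus_0, IH. reflexivity.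
Qed.

(** * Lengths, truncated subtraction and order *)

Lemma len_append V (G : list (fm V)) (x y : tm V (tSeq tN)) :
  len_ · (append_ · x · y) ≈[G] plus_ · (len_ · x) · (len_ · y).
Proof.
seq_ind (Eq (len_ · (append_ · v0 · lift y)) (plus_ · (len_ · v0) · (len_ · lift y))) x.
- rewrite append_nil, len_nil, plus_0_l. reflexivity.
- top IH. abstract_context. rewrite append_cons, !len_cons, plus_S_l, IH. reflexivity.
Qed.

Lemma len_tab V (G : list (fm V)) (f : tm V T1) k : len_ · (tab_ · f · k) ≈[G] k.
Proof.
nat_ind (Eq (len_ · (tab_ · lift f · v0)) v0) k.
- rewrite tab_0; apply len_nil.
- top IH. abstract_context.
  rewrite tab_S, len_append, len_cons, len_nil, IH, plus_S, plus_0. reflexivity.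
Qed.

Lemma monus_SS V (G : list (fm V)) u v :
  monus_ · (Succ · u) · (Succ · v) ≈[G] monus_ · u · v.
Proof.
nat_ind (Eq (monus_ · (Succ · lift u) · (Succ · v0)) (monus_ · lift u · v0)) v.
- rewrite monus_S, !monus_0, pred_S; reflexivity.
- top IH. abstract_context. rewrite monus_S, IH, monus_S. reflexivity.
Qed.

Lemma monus_0_l V (G : list (fm V)) u : monus_ · Zero · u ≈[G] Zero.
Proof.
nat_ind (Eq (monus_ · Zero · v0) Zero : fm (ext V tN)) u.
- apply monus_0.
- top IH. abstract_context. rewrite monus_S, IH. apply pred_0.
Qed.

Lemma monus_plus_r V (G : list (fm V)) u v : monus_ · (plus_ · u · v) · v ≈[G] u.
Proof.
nat_ind (Eq (monus_ · (plus_ · lift u · v0) · v0) (lift u)) v.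
- rewrite plus_0; apply monus_0.
- top IH. abstract_context. rewrite plus_S, monus_SS. exact IH.
Qed.

Lemma monus_plus_l V (G : list (fm V)) u v : monus_ · (plus_ · u · v) · u ≈[G] v.
Proof.
nat_ind (Eq (monus_ · (plus_ · v0 · lift v) · v0) (lift v)) u.
- rewrite plus_0_l; apply monus_0.
- top IH. abstract_context. rewrite plus_S_l, monus_SS. exact IH.
Qed.

Lemma monus_plus_0 V (G : list (fm V)) u v : monus_ · u · (plus_ · u · v) ≈[G] Zero.
Proof.
nat_ind (Eq (monus_ · v0 · (plus_ · v0 · lift v)) Zero) u.
- apply monus_0_l.
- top IH. abstract_context. rewrite plus_S_l, monus_SS. exact IH.
Qed.

Lemma le_total V (G : list (fm V)) m n :
  G ⊢ Or (Ex tN (Eq (lift n) (plus_ · lift m · v0)))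
         (Ex tN (Eq (lift m) (plus_ · lift n · v0))).
Proof.
nat_ind (Or (Ex tN (Eq (lift (lift n)) (plus_ · v1 · v0)))
            (Ex tN (Eq v1 (plus_ · lift (lift n) · v0)))) m.
- apply d_orI1, d_exI with (u := n); simp; eqn; symmetry; apply plus_0_l.
- eapply d_orE; [apply d_hyp; left; reflexivity| |];
  (eapply d_exE; [apply d_hyp; left; reflexivity|]); simp.
  + apply nat_cases with (n := v0); simp.
    * fetch 0 hz. fetch 1 hn. apply d_orI2, d_exI with (u := Succ · Zero); simp; eqn.
      abstract_context. rewrite hn, hz, plus_S, !plus_0. reflexivity.
    * fetch 0 hs. fetch 1 hn. apply d_orI1, d_exI with (u := v0); simp; eqn.
      abstract_context. rewrite hn, hs, plus_S, plus_S_l. reflexivity.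
  + fetch 0 hn. apply d_orI2, d_exI with (u := Succ · v0); simp; eqn.
    abstract_context. rewrite plus_S, <- hn. reflexivity.
Qed.

(** [m - (m - n)] is the minimum of [m] and [n], the length of the segment that [take_] produces.
    The inequality is given by a difference, as [search_stable] expects. *)
Lemma monus_monus_le V (G : list (fm V)) m n :
  G ⊢ Ex tN (Eq (plus_ · (monus_ · lift m · (monus_ · lift m · lift n)) · v0) (lift n)).
Proof.
eapply d_orE; [apply (le_total G m n)| |];
(eapply d_exE; [apply d_hyp; left; reflexivity|]); simp; fetch 0 hn.
- apply d_exI with (u := v0); simp; eqn. abstract_context.
  rewrite hn, monus_plus_0, monus_0. reflexivity.
- apply d_exI with (u := Zero); simp; eqn. abstract_context.
  rewrite hn, monus_plus_l, monus_plus_r. apply plus_0.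
Qed.

(** * The associate *)

(* [search_ · f · n] is [i + 1] for the least [i < n] with [f i <> 0], and [0] if there
   is none. *)
Definition search_ {V} : tm V (T1 ~> tN ~> tN) :=
  Lam T1 (Lam tN (Rec · v0 · Zero
    · Lam tN (Lam tN (cond_ · v1 · (cond_ · (v3 · v0) · Zero · (Succ · v0)) · v1)))).

(** A closed term applied to [f], so that the axioms on closed terms and application make the
    associate standard whenever [f] is. *)
Definition assoc_ {V} : tm V (T1 ~> T1) :=
  Lam T1 (Lam tN (search_ · v1 · (len_ · (decode_ · v0)))).

Lemma search_0 V (G : list (fm V)) f : search_ · f · Zero ≈[G] Zero.
Proof. unfold search_. beta_simp. apply rec0. Qed.

Lemma search_S V (G : list (fm V)) f n :
  search_ · f · (Succ · n) ≈[G]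
  cond_ · (search_ · f · n) · (cond_ · (f · n) · Zero · (Succ · n)) · (search_ · f · n).
Proof. unfold search_. beta_simp. rewrite recS. beta_simp. reflexivity. Qed.

Lemma assoc_code V (G : list (fm V)) f x :
  assoc_ · f · (code_ · x) ≈[G] search_ · f · (len_ · x).
Proof. unfold assoc_. beta_simp. rewrite decode_code. reflexivity. Qed.

Lemma assoc_search V (G : list (fm V)) f s :
  assoc_ · f · s ≈[G] search_ · f · (len_ · (decode_ · s)).
Proof. unfold assoc_. beta_simp. reflexivity. Qed.

(** Once an index is found, every later stage keeps it. Success is written as a successor so that
    [cond_S] applies. *)
Lemma search_stable V (G : list (fm V)) f n d w :
  search_ · f · n ≈[G] Succ · w -> search_ · f · (plus_ · n · d) ≈[G] Succ · w.
Proof.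
intro h.
nat_ind (Eq (search_ · lift f · (plus_ · lift n · v0)) (Succ · lift w)) d.
- rewrite plus_0; exact h.
- top IH. abstract_context. rewrite plus_S, search_S, IH, cond_S. reflexivity.
Qed.

Lemma neg_eq0 V (G : list (fm V)) u v :
  u ≈[G] v -> G ⊢ Neg (Eq u Zero) -> G ⊢ Neg (Eq v Zero).
Proof.
intro uv.
exact (leibniz (p := Neg (Eq v0 Zero)) (conj I I) uv).
Qed.

(** Subtracting 1 undoes the shift by which [search_] keeps index 0 apart from failure, just as
    [Value] does. *)
Lemma search_witness V (G : list (fm V)) f n :
  G ⊢ Or (Eq (search_ · f · n) Zero)
         (Neg (Eq (f · (monus_ · (search_ · f · n) · (Succ · Zero))) Zero)).
Proof.
nat_ind (Or (Eq (search_ · lift f · v0) Zero)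
         (Neg (Eq (lift f · (monus_ · (search_ · lift f · v0) · (Succ · Zero))) Zero))) n.
- apply d_orI1, search_0.
(* If nothing was found below [v0], the value of [f] at [v0] decides; otherwise the earlier result
   is kept. *)
- apply nat_cases with (n := search_ · lift f · v0); simp.
  + apply nat_cases with (n := lift f · v0); simp.
    * fetch 0 hf. fetch 1 hs. apply d_orI1; eqn. abstract_context.
      rewrite search_S, hs, cond_0, hf, cond_0. reflexivity.
    * fetch 0 hf. fetch 1 hs. apply d_orI2.
      abstract_context.
      apply neg_eq0 with (u := Succ · v0); [|apply epa, ax_succ_neq0].
      rewrite search_S, hs, cond_0, hf, cond_S, monus_SS, monus_0. symmetry. exact hf.
  + fetch 0 hs. fetch 1 IH.
    match type of IH with derives _ _ (Or ?a ?b) =>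
    apply d_orE with (p := a) (q := b); [exact IH| |] end.
    * apply absurd_S with (n := v0). fetch 0 hz. fetch 1 hs'. eqn.
      abstract_context. rewrite <- hs'. exact hz.
    * fetch 0 hn. fetch 1 hs'. apply d_orI2.
      abstract_context.
      refine (neg_eq0 _ hn).
      rewrite search_S, hs', cond_S. reflexivity.
Qed.

(** The bound [m + 1] makes the search reach [m], where it succeeds unless it did so earlier. The
    assumption is a member of the context, a form that passes to extended and lifted contexts. *)
Lemma search_found V (G : list (fm V)) f m :
  In (Neg (Eq (f · m) Zero)) G -> G ⊢ Pos (search_ · f · (Succ · m)).
Proof.
intro hm. unfold Pos, Lt, Le.
apply nat_cases with (n := search_ · f · m); simp.
- apply nat_cases with (n := f · m); simp.
  + apply bot_elim, d_impE with (p := Eq (f · m) Zero); hyp.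
  + fetch 0 hf. fetch 1 hs. eqn. abstract_context.
    rewrite search_S, hs, cond_0, hf, cond_S, monus_SS. apply monus_0_l.
- fetch 0 hs. eqn. abstract_context.
  rewrite search_S, hs, cond_S, monus_SS. apply monus_0_l.
Qed.

Lemma pos_neq0 V (G : list (fm V)) u p :
  u ≈[G] Zero -> G ⊢ Pos u -> G ⊢ p.
Proof.
intros hu hp. apply absurd_S with (n := Zero). unfold Pos, Lt, Le in hp. as_eqv hp. eqn.
rewrite hu, monus_0 in hp. exact hp.
Qed.

Lemma pos_eqv V (G : list (fm V)) u v : u ≈[G] v -> G ⊢ Pos u -> G ⊢ Pos v.
Proof.
unfold Pos, Lt, Le. intros uv h. as_eqv h. eqn. rewrite <- uv. exact h.
Qed.

(** Positivity on the segment means that the search succeeds within its length, which is at most the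
    length of [s], and hence at most that of [t]. By stability both longer searches return the same
    index. *)
Lemma assoc_prefix V (G : list (fm V)) f r s t n :
  G ⊢ Imp (Eq (code_ · (append_ · (decode_ · s) · (decode_ · r))) t)
        (Imp (Pos (assoc_ · f · (code_ · (take_ · (decode_ · s) · n))))
             (Eq (assoc_ · f · s) (assoc_ · f · t))).
Proof.
apply d_impI, d_impI.
pose (k := monus_ · n · (monus_ · n · (len_ · (decode_ · s)))).
apply nat_cases with (n := search_ · f · k).
- fetch 0 hz. fetch 1 hp.
  abstract_context.
  refine (pos_neq0 _ _ hp). rewrite assoc_code, take_tab, len_tab. exact hz.
- simp. eapply d_exE; [apply (monus_monus_le _ (lift n) (len_ · (decode_ · lift s)))|].
  unfold k; simp. fetch 0 hk. fetch 1 hs. fetch 3 ht. eqn. abstract_context.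
  assert (hs' := search_stable v0 hs). rewrite hk in hs'.
  rewrite !assoc_search, <- ht, decode_code, len_append, hs'.
  symmetry. apply search_stable, hs'.
Qed.

Lemma assoc_in_C V (G : list (fm V)) f m :
  In (Neg (Eq (f · m) Zero)) G -> G ⊢ InC (assoc_ · f).
Proof.
intro hm. unfold InC, finit, sinit, Prefix, scat. simp. apply d_andI.
(* A segment of length [m + 1] is long enough for the search to inspect [m], whatever the
   sequence. *)
- apply d_allI, d_exI with (u := Succ · lift m). simp.
  eapply pos_eqv; [symmetry; rewrite assoc_code, len_tab; reflexivity|].
  apply search_found.
  exact (in_map (flift (s := T1)) _ _ hm).
- apply d_allI, d_allI, d_allI, d_impI.
  eapply d_exE; [eapply d_andE1; hyp|].
  (* [v0] is the extension provided by [Prefix], and [v1] is the length [n], shifted by that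
     witness. *)
  eapply d_impE; [eapply d_impE; [apply assoc_prefix with (r := v0) (n := v1)|]|].
  + hyp.
  + eapply d_andE2. apply d_hyp; right; left. reflexivity.
Qed.

(** * Standardness and the derivation of transfer *)

Lemma st_closed V (G : list (fm V)) t (u : tm no_var t) :
  G ⊢ St (ren (fun s (x : no_var s) => match x with end) u).
Proof. apply d_ax, PQ_P, P_st_closed. Qed.

Lemma st_app V (G : list (fm V)) s t (f : tm V (s ~> t)) u :
  G ⊢ St f -> G ⊢ St u -> G ⊢ St (f · u).
Proof.
intros hf hu; eapply d_impE; [apply d_ax, PQ_P, P_st_app | now apply d_andI].
Qed.

(** Any value, at any argument [a], is a positive search result minus 1, so [search_witness] applies
    to the segment on which it is read off. *)
Lemma assoc_value V (G : list (fm V)) f a v :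
  G ⊢ Imp (Value (assoc_ · f) a v) (Neg (Eq (f · v) Zero)).
Proof.
apply d_impI. eapply d_exE; [apply d_hyp; left; reflexivity|].
unfold finit; simp.
match goal with |- derives _ ?G _ => assert (w := search_witness G (lift f) v0) end.
revert w; simp; intro w.
eapply d_orE; [exact w| |].
- fetch 0 hz. fetch 1 hp. apply d_andE1 in hp. refine (pos_neq0 _ _ hp).
  abstract_context. rewrite assoc_code, len_tab. exact hz.
- fetch 0 hn. fetch 1 hp. apply d_andE2 in hp. as_eqv hp. refine (neg_eq0 _ hn).
  abstract_context. rewrite hp, assoc_code, len_tab. reflexivity.
Qed.

Theorem theorem4p23 : proves P_QFAC10 (Imp GH_ns Pi01_TRANS).
Proof.
apply d_impI.
eapply d_exE; [apply d_hyp; left; reflexivity|].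
(* Afterwards [v2] is Gamma, [v1] is [f] and [v0] is the [m] with [f m] assumed nonzero; this
   assumption heads the context. *)
apply d_allI, d_impI, d_impI, d_allI, d_dne, d_impI.
match goal with |- derives _ ?D _ =>
  assert (inC : D ⊢ InC (assoc_ · v1));
  [ apply assoc_in_C with (m := v0); left; reflexivity |];
  assert (zero : D ⊢ All tN (Imp (St v0) (Eq (v2 · v0) Zero)));
  [ apply d_hyp; do 1 right; left; reflexivity |];
  assert (stf : D ⊢ St (V := ext (ext (ext no_var TGH) T1) tN) v1);
  [ apply d_hyp; do 2 right; left; reflexivity |];
  assert (hG : D ⊢ flift (flift (And (St v0) (And
     (AllSt T1 (Imp (InC v0) (All tN (GH v2 v1 v0))))
     (AllSt T1 (Imp (InC v0)
          (AllSt tN (All tN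
             (Imp (Neg (St v0)) (HhatEq v2 v1 v0 (v3 · v2 · v1))))))))
     : fm (ext no_var TGH))));
  [ apply d_hyp; do 3 right; left; reflexivity |];
  set (E := D) in *; clearbody E
end.
assert (stG : E ⊢ St (V := ext (ext (ext no_var TGH) T1) tN) v2) by exact (d_andE1 hG).
assert (stg : E ⊢ St (assoc_ · v1)) by exact (st_app (st_closed E assoc_) stf).
(* [Zero] is the code of the empty sequence. All three factors are standard, even though [m], which
   puts the associate in C, need not be. *)
set (v := v2 · (assoc_ · v1) · Zero : tm (ext (ext (ext no_var TGH) T1) tN) tN).
assert (stv : E ⊢ St v) by exact (st_app (st_app stG stg) (st_closed E Zero)).
apply d_andE2, d_andE1 in hG.
assert (gh : E ⊢ All tN (GH v3 (assoc_ · v2) v0)).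
{ refine (d_impE (d_impE _ stg) inC).
  exact (d_allE (assoc_ · v1) hG). }
assert (val : E ⊢ GH v2 (assoc_ · v1) Zero) by exact (d_allE Zero gh).
assert (neq : E ⊢ Neg (Eq (v1 · v) Zero)) by exact (d_impE (assoc_value _ _ _ _) val).
refine (d_impE neq (d_impE _ stv)).
exact (d_allE v zero).
Qed.
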